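(* Let $\mathscr{C}$ be a linear $[n,k,d]$ code over a finite field which has $\{(n_j,r_j,\delta_j)\}_{j\in[s]}$-locality (i.e. $\mathscr{C}$ is a UD-$(r,\delta)$-LRC with these parameters). Then $$k \le \sum_{j=1}^{s} k_j,$$ where $k_j$ is the integer determined by $(n_j,r_j,\delta_j)$ as defined in the context.
   Context: For an integer $i$, $[i]=\{1,\dots,i\}$; $\sqcup$ denotes disjoint union. An $[n,k,d]$ code is a linear code of length $n$, dimension $k\ge 1$ and minimum Hamming distance $d$. For $\mathcal{T}\subset[n]$, $\mathscr{C}|_{\mathcal{T}}$ denotes the punctured code with support $\mathcal{T}$ (restriction of the codewords to the coordinates in $\mathcal{T}$). $(r,\delta)$-locality: the symbol with index $i\in[n]$ of $\mathscr{C}$ has $(r,\delta)$-locality if there is a set $\mathcal{S}_i\subset[n]$ with $i\in\mathcal{S}_i$, $|\mathcal{S}_i|\le r+\delta-1$, and $d(\mathscr{C}|_{\mathcal{S}_i})\ge\delta$, where $d(\cdot)$ is the minimum Hamming distance. UD-$(r,\delta)$-LRC: let $[n]=\bigsqcup_{j=1}^{s}\mathcal{N}_j$ with $|\mathcal{N}_j|=n_j$, and let $r_j,\delta_j$ be positive integers, $j\in[s]$. The code $\mathscr{C}$ has $\{(n_j,r_j,\delta_j)\}_{j\in[s]}$-locality if for every $j\in[s]$ and every $i\in\mathcal{N}_j$ the symbol with index $i$ has $(r_j,\delta_j)$-locality via a set contained in $\mathcal{N}_j$, i.e. there is a set $\mathcal{S}_i\subset\mathcal{N}_j$ with $i\in\mathcal{S}_i$,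 $|\mathcal{S}_i|\le r_j+\delta_j-1$, and $d(\mathscr{C}|_{\mathcal{S}_i})\ge\delta_j$. No ordering of the $r_j$ or $\delta_j$ is assumed. Auxiliary parameters: for $j\in[s]$ let $p_j,q_j$ be the integers with $n_j=p_j(r_j+\delta_j-1)+q_j$ and $0\le q_j\le r_j+\delta_j-2$; let $m_j=\frac{n_j}{r_j+\delta_j-1}$ (a rational number); and let $$k_j=\begin{cases}\lfloor m_j\rfloor r_j & \text{if } 0\le q_j\le\delta_j-2,\\ n_j-\lceil m_j\rceil(\delta_j-1) & \text{if } \delta_j-1\le q_j\le r_j+\delta_j-2.\end{cases}$$ *)

(* Defs.v *)
From HB Require Import structures.
From mathcomp Require Import all_boot all_order all_algebra.
Set Implicit Arguments.
Unset Strict Implicit.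
Unset Printing Implicit Defensive.
Import Order.TTheory GRing.Theory Num.Theory.
Local Open Scope ring_scope.

Definition hdist (F : finFieldType) (n : nat) (x y : 'rV[F]_n) : nat :=
  #|[set i | x 0 i != y 0 i]|.

(* [None] stands for +oo, the minimum over the empty set: it is the value at
   the zero code, which can arise by puncturing a nonzero code. *)
Definition min_dist (F : finFieldType) (n : nat) (C : {vspace 'rV[F]_n}) :
    option nat :=
  \big[oAC minnA minnC/None]_(xy : 'rV[F]_n * 'rV[F]_n |
      [&& xy.1 \in C, xy.2 \in C & xy.1 != xy.2]) Some (hdist xy.1 xy.2).

Definition min_dist_ge (F : finFieldType) (n : nat) (C : {vspace 'rV[F]_n})
    (delta : nat) : bool :=
  if min_dist C is Some d then (delta <= d)%N else true.

Definition linear_code (F : finFieldType) (n k d : nat)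
    (C : {vspace 'rV[F]_n}) : Prop :=
  [/\ (1 <= k)%N, \dim C = k & min_dist C = Some d].

Definition punctured (F : finFieldType) (n : nat) (C : {vspace 'rV[F]_n})
    (T : {set 'I_n}) : {vspace 'rV[F]_#|T|} :=
  (linfun (fun c : 'rV[F]_n => colsub (@enum_val _ (mem T)) c) @: C)%VS.

Definition locality_via (F : finFieldType) (n : nat) (C : {vspace 'rV[F]_n})
    (r delta : nat) (i : 'I_n) (S : {set 'I_n}) : Prop :=
  [/\ i \in S, (#|S| <= r + delta - 1)%N & min_dist_ge (punctured C S) delta].

(* Unlike [finset.partition], empty blocks are allowed. *)
Definition disjoint_union (n s : nat) (N : 'I_s -> {set 'I_n}) : Prop :=
  \bigcup_(j < s) N j = [set: 'I_n] /\
  (forall j1 j2 : 'I_s, j1 != j2 -> [disjoint N j1 & N j2]).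

Definition ud_locality (F : finFieldType) (n : nat) (C : {vspace 'rV[F]_n})
    (s : nat) (nn r delta : 'I_s -> nat) : Prop :=
  exists N : 'I_s -> {set 'I_n},
    [/\ disjoint_union N,
        forall j, #|N j| = nn j
      & forall j i, i \in N j ->
          exists2 S : {set 'I_n},
            S \subset N j & locality_via C (r j) (delta j) i S].

Definition locality_q (nj r delta : nat) : nat := (nj %% (r + delta - 1))%N.

Definition locality_m (nj r delta : nat) : rat :=
  nj%:R / (r + delta - 1)%N%:R.

(* The test is made in [int], so that it fails for [delta = 1], when the
   bound is -1. Since [locality_q nj r delta <= r + delta - 2] for positive
   [r] and [delta], the second branch is the range from [delta - 1] up. *)
Definition locality_k (nj r delta : nat) : int :=
  if (locality_q nj r delta)%:Z <= delta%:Z - 2 then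
    Num.floor (locality_m nj r delta) * r%:Z
  else nj%:Z - Num.ceil (locality_m nj r delta) * (delta%:Z - 1).

(* Main.v *)
(** For a set [T] of coordinates let [K T] be the subcode of the codewords that
    vanish on [T].  Adjoining [a] coordinates to [T] lowers [\dim (K T)] by at
    most [a], and by at most [max (0, a - (delta - 1))] when they complete a
    repair set [S]: a codeword that vanishes on [S] outside fewer than [delta]
    positions vanishes on [S].  Exhaust each block by repair sets, starting from
    the union of the previous blocks.  A repair set contributes at most
    [a <= r + delta - 1] new coordinates, and by convexity the total loss over a
    block of size [nj] is largest when all steps but one have [a] equal to
    [r + delta - 1]; that maximum is [kj].  The total loss over all the blocks
    is [k], as only 0 vanishes everywhere. *)
Require Import Defs.
From HB Require Import structures.
From mathcomp Require Import all_boot all_order all_algebra.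
From mathcomp Require Import zify.
Set Implicit Arguments.
Unset Strict Implicit.
Unset Printing Implicit Defensive.
Import Order.TTheory GRing.Theory Num.Theory.
Local Open Scope ring_scope.

(** The [k_j] of a block of size [m], with both cases in one formula: truncated subtraction makes a
    remainder below [delta - 1] count 0. *)
Definition max_rank (r delta m : nat) : nat :=
  (m %/ (r + delta - 1) * r + (m %% (r + delta - 1) - (delta - 1)))%N.

(** Put [f x = max (0, x - (delta - 1))] and let [q] be the remainder of [m]. If [q + a < L], then
    [f q + f a <= f (q + a)]. Otherwise [q] and [a] lie between [q + a - L] and [L], and convexity
    gives [f q + f a <= f L + f (q + a - L)], where [f L = r]. *)
Lemma max_rank_step (r delta m a : nat) :
  (0 < r)%N -> (0 < delta)%N -> (a <= r + delta - 1)%N ->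
  (max_rank r delta m + (a - (delta - 1)) <= max_rank r delta (m + a))%N.
Proof.
move=> r_gt0 d_gt0; rewrite /max_rank.
set L := (r + delta - 1)%N => aL.
have L_gt0 : (0 < L)%N by rewrite /L; lia.
have qL := ltn_pmod m L_gt0.
have -> : (m + a = m %/ L * L + (m %% L + a))%N by rewrite addnA -divn_eq.
rewrite divnMDl // modnMDl.
move: (m %/ L)%N (m %% L)%N qL => p q qL.
have [qaL|qaL] := ltnP (q + a) L.
  by rewrite divn_small // modn_small //; lia.
have -> : (q + a = 1 * L + (q + a - L))%N by lia.
rewrite divnMDl // modnMDl divn_small ?modn_small; try lia.
Qed.

Lemma max_rank_le_locality_k (r delta m : nat) :
  (0 < r)%N -> (0 < delta)%N ->
  (max_rank r delta m)%:Z <= locality_k m r delta.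
Proof.
move=> r_gt0 d_gt0.
rewrite /max_rank /locality_k /locality_q /locality_m.
set L := (r + delta - 1)%N.
have L_gt0 : (0 < L)%N by rewrite /L; lia.
have LQ_gt0 : 0 < L%:R :> rat by rewrite ltr0n.
have eq_m := divn_eq m L; have qL := ltn_pmod m L_gt0.
move: (m %/ L)%N (m %% L)%N eq_m qL => p q eq_m qL.
case: ifP => qd.
  have -> : Num.floor (m%:R / L%:R : rat) = p%:Z.
    apply: floor_def; rewrite ler_pdivlMr // ltr_pdivrMr // -PoszD addn1.
    by rewrite -!pmulrn -!natrM ler_nat ltr_nat eq_m; lia.
  have -> : (q - (delta - 1) = 0)%N by lia.
  by rewrite addn0 PoszM.
(* For [q = 0] the ceiling is [p], not [p + 1]; but this branch then forces [delta = 1], and its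
   factor [delta - 1] is 0. *)
have [q0|q_gt0] := posnP q.
  have -> : delta = 1%N by lia.
  by rewrite subrr mulr0 subr0 q0; rewrite /L in eq_m; nia.
have -> : Num.ceil (m%:R / L%:R : rat) = p%:Z + 1.
  apply: ceil_def; rewrite ler_pdivrMr // ltr_pdivlMr // addrK -PoszD addn1.
  by rewrite -!pmulrn -!natrM ler_nat ltr_nat eq_m; lia.
rewrite /L in eq_m qL *; nia.
Qed.

Lemma min_dist_geP (F : finFieldType) (n : nat) (C : {vspace 'rV[F]_n})
    (delta : nat) (x y : 'rV[F]_n) :
  min_dist_ge C delta -> x \in C -> y \in C -> x != y ->
  (delta <= hdist x y)%N.
Proof.
move=> + xC yC xy; rewrite /min_dist_ge /min_dist.
rewrite (bigD1 (x, y)) /= ?xC ?yC //.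
by case: (\big[_/_]_(_ | _) _) => [e|] //=; rewrite leq_min => /andP[].
Qed.

Section Shortening.
Variables (F : finFieldType) (n : nat).
Implicit Types (C : {vspace 'rV[F]_n}) (B S T E N : {set 'I_n}).

(** The map under which [punctured C T] is the image of [C]. *)
Definition restrict T : 'Hom('rV[F]_n, 'rV[F]_#|T|) :=
  linfun (fun c : 'rV[F]_n => colsub (@enum_val _ (mem T)) c).

Lemma restrictE T (c : 'rV[F]_n) :
  restrict T c = colsub (@enum_val _ (mem T)) c.
Proof. exact: lfunE. Qed.

(** The subcode [K T], written with a kernel so that rank-nullity applies. *)
Definition shortened C T : {vspace 'rV[F]_n} := (C :&: lker (restrict T))%VS.

Lemma shortenedP C T (c : 'rV[F]_n) :
  reflect (c \in C /\ {in T, forall i, c 0 i = 0}) (c \in shortened C T).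
Proof.
rewrite memv_cap memv_ker restrictE.
apply: (iffP andP) => -[cC c0]; split=> //.
  move=> i iT; move/eqP/rowP/(_ (enum_rank_in iT i)): c0.
  by rewrite !mxE enum_rankK_in.
by apply/eqP/rowP=> i; rewrite !mxE c0 // enum_valP.
Qed.

Lemma shortenedS C T E : E \subset T -> (shortened C T <= shortened C E)%VS.
Proof.
move=> ET; apply/subvP=> c /shortenedP[cC c0].
by apply/shortenedP; split=> // i /(subsetP ET); apply: c0.
Qed.

Lemma shortenedU C T E : shortened C (T :|: E) = shortened (shortened C T) E.
Proof.
apply/vspaceP=> c; apply/shortenedP/shortenedP.
  move=> [cC c0]; split; last by move=> i iE; rewrite c0 // inE iE orbT.
  by apply/shortenedP; split=> // i iT; rewrite c0 // inE iT.
move=> [/shortenedP[cC cT] cE]; split=> // i.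
by rewrite inE => /orP[/cT|/cE].
Qed.

Lemma dim_shortenedU C T E :
  (\dim (shortened C T) <= \dim (shortened C (T :|: E)) + #|E|)%N.
Proof.
rewrite shortenedU -(limg_ker_dim (restrict E) (shortened C T)).
by rewrite leq_add2l (leq_trans (dimvS (subvf _))) // dimvf /dim /= mul1n.
Qed.

Lemma shortened_repair C (delta : nat) S E :
  min_dist_ge (punctured C S) delta -> E \subset S -> (#|E| < delta)%N ->
  shortened C (S :\: E) = shortened C S.
Proof.
move=> dS ES Ed; apply/eqP.
rewrite eqEsubv [X in _ && X]shortenedS ?subsetDl //.
rewrite andbT; apply/subvP=> c /shortenedP[cC c0].
rewrite memv_cap cC memv_ker /=; apply: contraTT Ed => cS; rewrite -leqNgt.
have cP : restrict S c \in punctured C S by apply: memv_img.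
apply: leq_trans (min_dist_geP dS cP (mem0v _) cS) _.
(* The support of the restricted word, carried back to coordinates in ['I_n], lies in [E]. *)
rewrite /hdist -(card_imset _ (@enum_val_inj _ (mem S))).
apply/subset_leq_card/subsetP=> _ /imsetP[i + ->].
rewrite inE restrictE !mxE; apply: contraNT => iE.
by rewrite c0 // inE iE enum_valP.
Qed.

Lemma dim_shortened_repair C (r delta : nat) B (i : 'I_n) S T :
  (0 < delta)%N -> locality_via C r delta i S ->
  (\dim (shortened C (B :|: T)) <=
   \dim (shortened C (B :|: (T :|: S))) + (#|S :\: T| - (delta - 1)))%N.
Proof.
move=> d_gt0 [_ _ dS]; set A := S :\: T.
(* [E] takes [delta - 1] of the new coordinates, or all of them if there are fewer. Only those in
   [A :\: E] are paid for; [E] then comes free by [shortened_repair]. *)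
pose E : {set 'I_n} := [set i in take (delta - 1) (enum A)].
have EA : E \subset A.
  by apply/subsetP=> j; rewrite inE => /mem_take; rewrite mem_enum.
have cardE : #|E| = minn (delta - 1) #|A|.
  rewrite cardsE (card_uniqP _) ?take_uniq ?enum_uniq //.
  by rewrite size_take_min -cardE.
have ES : E \subset S by apply: subset_trans EA (subsetDl S T).
have -> : (#|A| - (delta - 1) = #|A :\: E|)%N.
  by rewrite cardsD (setIidPr EA) cardE; lia.
apply: leq_trans (dim_shortenedU C _ (A :\: E)) _.
rewrite leq_add2r dimvS // [B :|: (T :|: S)]setUA [X in (_ <= X)%VS]shortenedU.
apply/subvP=> c cK; apply/shortenedP; split.
  by apply: (subvP (shortenedS C _) _ cK); apply: subsetUl.
have : c \in shortened C S.
  rewrite -(shortened_repair dS ES); last by rewrite cardE; lia.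
  (* A coordinate of [S :\: E] is in [T] or in [A :\: E]. *)
  apply: (subvP (shortenedS C _) _ cK); apply/subsetP=> j.
  rewrite !inE => /andP[-> ->] /=.
  by case: (j \in T); rewrite ?orbT.
by case/shortenedP.
Qed.

Lemma dim_shortened_block C (r delta : nat) B N :
  (0 < r)%N -> (0 < delta)%N ->
  (forall i, i \in N ->
     exists2 S : {set 'I_n}, S \subset N & locality_via C r delta i S) ->
  (\dim (shortened C B) <=
   \dim (shortened C (B :|: N)) + max_rank r delta #|N|)%N.
Proof.
move=> r_gt0 d_gt0 locN.
(* [T] is the part of the block already exhausted, and [m] bounds what is left. *)
suff cover m T : (#|N :\: T| <= m)%N -> T \subset N ->
    (\dim (shortened C B) <=
     \dim (shortened C (B :|: T)) + max_rank r delta #|T|)%N ->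
    (\dim (shortened C B) <=
     \dim (shortened C (B :|: N)) + max_rank r delta #|N|)%N.
  by apply: (cover #|N| set0); rewrite ?sub0set ?setD0 // setU0 leq_addr.
elim: m T => [|m IHm] T.
  rewrite leqn0 cards_eq0 setD_eq0 => NT TN.
  by have -> : T = N by apply/eqP; rewrite eqEsubset TN.
move=> NTm TN dimT.
have [NT|[i]] := set_0Vmem (N :\: T).
  by apply: (IHm T) => //; rewrite NT cards0.
rewrite inE => /andP[iT iN]; have [S SN locS] := locN i iN.
have [iS Sle _] := locS.
apply: (IHm (T :|: S)); last 1 first.
- apply: leq_trans dimT _.
  have STle : (#|S :\: T| <= r + delta - 1)%N.
    by apply: leq_trans Sle; rewrite subset_leq_card // subsetDl.
  have := max_rank_step #|T| r_gt0 d_gt0 STle.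
  have -> : (#|T| + #|S :\: T| = #|T :|: S|)%N.
    by rewrite cardsU cardsD setIC addnBA // subset_leq_card ?subsetIr ?subsetIl.
  have := dim_shortened_repair B T d_gt0 locS; lia.
(* The coordinate [i] lies in [S] but not in [T], so the remainder strictly shrinks. *)
- rewrite -ltnS (leq_trans _ NTm) // proper_card // properEneq.
  rewrite setDS ?subsetUl // andbT; apply: contraTneq iT => /setP/(_ i).
  by rewrite !inE iS orbT iN /= andbT => /esym/negbFE ->.
- by rewrite subUset TN.
Qed.

End Shortening.

Theorem theorem1 (F : finFieldType) (n k d : nat) (C : {vspace 'rV[F]_n})
  (s : nat) (nn r delta : 'I_s -> nat)
  (r_gt0 : forall j, (0 < r j)%N) (delta_gt0 : forall j, (0 < delta j)%N)
  (codeC : linear_code k d C)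
  (locC : ud_locality C nn r delta) :
  k%:Z <= \sum_(j < s) locality_k (nn j) (r j) (delta j).
Proof.
case: codeC => _ <- _; case: locC => N [[covN _] cardN locN].
have dimC0 : \dim (shortened C set0) = \dim C.
  congr (\dim _); apply/vspaceP=> c.
  by apply/shortenedP/idP=> [[]//|cC]; split=> // i; rewrite inE.
have dimCT : \dim (shortened C setT) = 0%N.
  apply/eqP; rewrite dimv_eq0 -subv0; apply/subvP=> c /shortenedP[_ c0].
  by rewrite memv0; apply/eqP/rowP=> i; rewrite c0 ?inE // mxE.
(* Stated for any list of blocks, to allow induction: the head block is adjoined to the union over
   the tail. *)
suff step (e : seq 'I_s) :
    (\dim (shortened C set0) <= \dim (shortened C (\bigcup_(j <- e) N j)) +
     \sum_(j <- e) max_rank (r j) (delta j) (nn j))%N.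
  have := step (index_enum 'I_s); rewrite covN dimCT dimC0 add0n => le_dim.
  apply: le_trans (_ : (\sum_j max_rank (r j) (delta j) (nn j))%N%:Z <= _) => //.
  rewrite (big_morph Posz PoszD (erefl _)); apply: ler_sum => j _.
  exact: max_rank_le_locality_k.
elim: e => [|j e IHe]; first by rewrite !big_nil addn0.
rewrite !big_cons [N j :|: _]setUC; apply: leq_trans IHe _.
rewrite addnA leq_add2r -cardN; apply: dim_shortened_block => // i.
exact: locN.
Qed.
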